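(* Let $\mathcal R=\langle S\mid R\rangle$ be a finitely presented rack. If $\mathcal R$ is finite, then ENUMERATE$(S,R,M)$ completes for some positive integer $M$.
   Context: RACKS AND PRESENTATIONS. A rack is a set with two binary operations $\rhd,\rhd^{-1}$ such that $(x\rhd y)\rhd^{-1}y=(x\rhd^{-1}y)\rhd y=x$ and $(x\rhd y)\rhd z=(x\rhd z)\rhd(y\rhd z)$ for all $x,y,z$. Write $x^y=x\rhd y$, $x^{\bar y}=x\rhd^{-1}y$; a word in the exponent acts letter by letter from left to right. $F(S)$ is the free group on $S$, and $\bar w$ denotes the inverse of $w\in F(S)$; $\bar S=\{\bar x: x\in S\}$. The free rack $FR(S)$ is the set of symbols $a^w$ ($a\in S$, $w\in F(S)$), with $a^u=b^v$ iff $a=b$ in $S$ and $u=v$ in $F(S)$, and operations $a^u\rhd b^v=a^{u\bar v b v}$, $a^u\rhd^{-1}b^v=a^{u\bar v\bar b v}$. Given $S=\{x_1,\dots,x_g\}$ ($g\ge1$) and a finite set $R$ of pairs $(x_i^{u},x_j)$, written $x_i^u=x_j$, with $x_i,x_j\in S$ and $u$ a reduced word in $F(S)$ (primary relations), $\mathcal R=\langle S\mid R\rangle$ is the quotient of $FR(S)$ by the smallest congruence (equivalence relation respecting both operations) containing $R$. TABLES. An enumeration table for $\mathcal R$ is $\mathcal E=(\omega,A,\tau,\rho)$, where $\omega$ is the number of rows, $A$ is a partial function $\{1,\dots,\omega\}\times(S\cup\bar S)\to\{1,\dots,\omega\}$ (write $i^y$ for $A(i,y)$, possibly undefined), $\tau:\{1,\dots,\omega\}\to\mathcal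 R$ and $\rho:\{1,\dots,\omega\}\to\{1,\dots,\omega\}$ are functions, and $\rho(i)\le i$ for all $i$. The live elements are $\Omega=\{i:\rho(i)=i\}$ (always with respect to the current $\rho$). REP$(i)$ is the least element of $\{\rho^t(i):t\ge0\}$, obtained by iterating $\rho$ until a fixed point is reached. ALGORITHMS (all act on the current table; loops over $R$, $R_2$, $S\cup\bar S$ use fixed orders, not depending on $M$). INIT: $\omega:=g$, $A$ empty, $\tau(i):=x_i$ and $\rho(i):=i$ for $1\le i\le g$; $R_2$ (secondary relations) is the set of reduced forms of the words $\bar u x_i u\bar x_j$ for $x_i^u=x_j$ in $R$. DEFINE$(i,y)$: $\omega:=\omega+1$; $i^y:=\omega$; $\omega^{\bar y}:=i$; $\tau(\omega):=\tau(i)^y$; $\rho(\omega):=\omega$. DEDUCTION$(i,y,j)$: $i^y:=j$; $j^{\bar y}:=i$. SCAN$(i,w,j)$ with $w=y_1\cdots y_t$ reduced: set $f:=1$, $b:=t$, $k:=i$, $\ell:=j$. Repeat: while $f\le b$ and $k^{y_f}$ is defined, set $k:=k^{y_f}$, $f:=f+1$; then while $f\le b$ and $\ell^{\bar y_b}$ is defined, set $\ell:=\ell^{\bar y_b}$, $b:=b-1$. If $f<b$, call DEFINE$(k,y_f)$ and repeat; if $f=b$, call DEDUCTION$(k,y_f,\ell)$ and stop; if $f>b$ and $k\ne\ell$, call COINCIDENCE$(k,\ell)$ and stop; if $f>b$ and $k=\ell$, stop. UPDATE$(i)$: set $\rho(j):=$ REP$(i)$ for all $j$ in $\{\rho^t(i):t\ge0\}$.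 MERGE$(m,n)$ (with a queue $Q$): $\mu:=$ REP$(m)$, $\nu:=$ REP$(n)$; if $\mu\ne\nu$, append $\max(\mu,\nu)$ to $Q$ and set $\rho(\max(\mu,\nu)):=\min(\mu,\nu)$. COINCIDENCE$(m,n)$: let $Q$ be empty; call MERGE$(m,n)$. Process the elements $d$ of $Q$ in order (including those appended meanwhile) until all are processed: for each $x\in S\cup\bar S$, if $d^x$ is defined, say $d^x=e$, then: undefine $d^x$ and $e^{\bar x}$; set $\delta:=$ REP$(d)$, UPDATE$(d)$; $\epsilon:=$ REP$(e)$, UPDATE$(e)$; if $\delta^x$ is defined, MERGE$(\epsilon,\delta^x)$; else if $\epsilon^{\bar x}$ is defined, MERGE$(\delta,\epsilon^{\bar x})$; else set $\delta^x:=\epsilon$, $\epsilon^{\bar x}:=\delta$. ENUMERATE$(S,R,M)$: run INIT. For each $x_i^u=x_j$ in $R$, call SCAN$($REP$(i),u,$REP$(j))$. Set $i:=1$. While $i\le\max(\Omega)$ and $i\le M$: (1) for each $w\in R_2$, if $i\in\Omega$ call SCAN$(i,w,i)$, otherwise break off this loop; (2) if $i\in\Omega$, for each $y\in S\cup\bar S$ with $i^y$ undefined call DEFINE$(i,y)$; (3) $i:=i+1$. After the loop, if $i>\max(\Omega)$ return $\mathcal E$ (then the process is said to complete); otherwise return ''run limit exceeded''. *)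

(* Defs.v *)
From HB Require Import structures.
From mathcomp Require Import all_boot.
From mathcomp Require Import boolp classical_sets cardinality.

Set Implicit Arguments.
Unset Strict Implicit.
Unset Printing Implicit Defensive.

Local Open Scope quotient_scope.

(** * Racks *)

HB.mixin Record isRack T := {
  rop : T -> T -> T;
  rinv : T -> T -> T;
  ropK : forall x y, rinv (rop x y) y = x;
  rinvK : forall x y, rop (rinv x y) y = x;
  ropD : forall x y z, rop (rop x y) z = rop (rop x z) (rop y z)
}.

#[short(type="rackType")]
HB.structure Definition Rack := {T of isRack T}.

Declare Scope rack_scope.
Delimit Scope rack_scope with rack.
Local Open Scope rack_scope.
Notation "x |> y" := (rop x y) (at level 40, left associativity) : rack_scope.
Notation "x |>^-1 y" := (rinv x y) (at level 40, left associativity)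
  : rack_scope.

Inductive generated_congruence (T : rackType) (B : T -> T -> Prop)
    : T -> T -> Prop :=
| gc_base x y : B x y -> generated_congruence B x y
| gc_refl x : generated_congruence B x x
| gc_sym x y : generated_congruence B x y -> generated_congruence B y x
| gc_trans x y z : generated_congruence B x y ->
    generated_congruence B y z -> generated_congruence B x z
| gc_rop x x' y y' : generated_congruence B x x' ->
    generated_congruence B y y' -> generated_congruence B (x |> y) (x' |> y')
| gc_rinv x x' y y' : generated_congruence B x x' ->
    generated_congruence B y y' ->
    generated_congruence B (x |>^-1 y) (x' |>^-1 y').

(** * Free groups, as reduced words *)

(* [(i, false)] is the letter x_i and [(i, true)] the letter \bar x_i. *)
Definition letter (g : nat) : Type := ('I_g * bool)%type.

Definition bar g (y : letter g) : letter g := (y.1, ~~ y.2).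

Definition word (g : nat) : Type := seq (letter g).

Definition word_inv g (w : word g) : word g := rev [seq bar y | y <- w].

Definition reduced g (w : word g) : bool := sorted (fun y z => z != bar y) w.

(* Left multiplication of a reduced word by one letter. *)
Definition push g (y : letter g) (w : word g) : word g :=
  if w is z :: w' then if z == bar y then w' else y :: w else [:: y].

Definition wmul g (u v : word g) : word g := foldr (@push g) v u.

Section FreeGroup.
Variable g : nat.
Implicit Types (y z : letter g) (u v w : word g).

Lemma barK : involutive (@bar g).
Proof. by case=> i b; rewrite /bar /= negbK. Qed.

Lemma word_invK : involutive (@word_inv g).
Proof.
by move=> w; rewrite /word_inv map_rev revK -map_comp map_id_in // => y _ /=;
  rewrite barK.
Qed.

Lemma reduced_push y w : reduced w -> reduced (push y w).
Proof.
case: w => [//|z w] /=; case: eqP => [_|/eqP nzy] rw; first exact: path_sorted rw.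
by rewrite /= nzy.
Qed.

Lemma pushK y w : reduced w -> push (bar y) (push y w) = w.
Proof.
case: w => [|z w] /=; first by rewrite barK eqxx.
case: (altP (z =P bar y)) => [-> |_] /=; last by rewrite barK eqxx.
by case: w => [//|t w] /= /andP[/negPf ->].
Qed.

Lemma pushVK y w : reduced w -> push y (push (bar y) w) = w.
Proof. by move=> rw; rewrite -{1}(barK y) pushK. Qed.

Lemma reduced_wmul u v : reduced v -> reduced (wmul u v).
Proof. by move=> rv; elim: u => //= y u; apply: reduced_push. Qed.

Lemma wmul_push y u v : reduced v -> wmul (push y u) v = push y (wmul u v).
Proof.
move=> rv; case: u => [//|z u] /=; case: eqP => [->|//].
by rewrite pushVK // reduced_wmul.
Qed.

Lemma wmulA u v w : reduced v -> reduced w ->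
  wmul u (wmul v w) = wmul (wmul u v) w.
Proof.
by move=> rv rw; elim: u => //= y u IH; rewrite wmul_push ?IH.
Qed.

Lemma wmulw0 u : reduced u -> wmul u [::] = u.
Proof.
elim: u => //= y u IH ru; rewrite (IH (path_sorted ru)) {IH}.
by case: u ru => //= z u /andP[/negPf ->].
Qed.

Lemma wmulVw u : reduced u -> wmul (word_inv u) u = [::].
Proof.
have push_bar y w : push (bar y) (y :: w) = w by rewrite /push barK eqxx.
elim: u => // y u IH ru; rewrite /word_inv map_cons rev_cons -cats1.
rewrite /wmul foldr_cat [foldr _ (y :: u) _]push_bar.
exact/IH/(path_sorted ru).
Qed.

Lemma reduced_inv u : reduced u -> reduced (word_inv u).
Proof.
rewrite /reduced /word_inv rev_sorted sorted_map; apply: sub_sorted => y z /=.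
by rewrite barK; apply: contra => /eqP ->.
Qed.

End FreeGroup.

Record free_group (g : nat) := FreeGroup {
  fg_word : word g;
  fg_reduced : reduced fg_word
}.
HB.instance Definition _ g := [isSub for @fg_word g].
HB.instance Definition _ g := [Choice of free_group g by <:].

Section FreeGroupInstance.
Variable g : nat.
Implicit Types u v w : free_group g.

Definition fg_one : free_group g := @FreeGroup g [::] isT.
Definition fg_inv u : free_group g := FreeGroup (reduced_inv (valP u)).
Definition fg_mul u v : free_group g := FreeGroup (reduced_wmul (val u) (valP v)).

Fact fg_mulA : associative fg_mul.
Proof. by move=> u v w; apply/val_inj/wmulA; apply: valP. Qed.
Fact fg_mul1g : left_id fg_one fg_mul.
Proof. by move=> u; apply/val_inj. Qed.
Fact fg_mulg1 : right_id fg_one fg_mul.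
Proof. by move=> u; apply/val_inj/wmulw0/valP. Qed.
Fact fg_mulVg : left_inverse fg_one fg_inv fg_mul.
Proof. by move=> u; apply/val_inj/wmulVw/valP. Qed.
Fact fg_mulgV : right_inverse fg_one fg_inv fg_mul.
Proof.
move=> u; apply/val_inj => /=; rewrite -[X in wmul X _]word_invK.
exact/wmulVw/reduced_inv/valP.
Qed.

HB.instance Definition _ := isGroup.Build (free_group g)
  fg_mulA fg_mul1g fg_mulg1 fg_mulVg fg_mulgV.

Definition fg_gen (i : 'I_g) : free_group g := @FreeGroup g [:: (i, false)] isT.

End FreeGroupInstance.

(** * Free racks and presentations *)

(* [(a, w)] is the symbol a^w. *)
Definition free_rack (g : nat) : Type := ('I_g * free_group g)%type.
HB.instance Definition _ g := Choice.on (free_rack g).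

Section FreeRack.
Variable g : nat.
Implicit Types x y z : free_rack g.

Definition fr_op x y : free_rack g :=
  (x.1, (x.2 * y.2^-1 * fg_gen y.1 * y.2)%g).
Definition fr_inv x y : free_rack g :=
  (x.1, (x.2 * y.2^-1 * (fg_gen y.1)^-1 * y.2)%g).

Fact fr_opK x y : fr_inv (fr_op x y) y = x.
Proof. by case: x y => a u [b v]; rewrite /fr_inv /fr_op /= !mulgK mulgVK. Qed.
Fact fr_invK x y : fr_op (fr_inv x y) y = x.
Proof.
by case: x y => a u [b v]; rewrite /fr_inv /fr_op /= mulgK mulgVK mulgVK.
Qed.
Fact fr_opD x y z : fr_op (fr_op x y) z = fr_op (fr_op x z) (fr_op y z).
Proof.
case: x y z => a u [b v] [c w]; rewrite /fr_op /=; congr (_, _).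
by rewrite !invgM !invgK !mulgA !(mulgK, mulgVK).
Qed.

HB.instance Definition _ := isRack.Build (free_rack g) fr_opK fr_invK fr_opD.

Definition fr_gen (i : 'I_g) : free_rack g := (i, 1%g).

End FreeRack.

(* [(i, u, j)] is the primary relation x_i^u = x_j. *)
Definition primary_relation (g : nat) : Type := ('I_g * free_group g * 'I_g)%type.

Definition relation_pair g (R : seq (primary_relation g)) (x y : free_rack g) : Prop :=
  exists i u j, (i, u, j) \in R /\ x = (i, u) /\ y = fr_gen j.

Section PresentedRack.
Variables (g : nat) (R : seq (primary_relation g)).

Definition rack_eq (x y : free_rack g) : bool :=
  `[< generated_congruence (relation_pair R) x y >].

Fact rack_eq_refl : reflexive rack_eq.
Proof. by move=> x; apply/asboolP/gc_refl. Qed.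
Fact rack_eq_sym : symmetric rack_eq.
Proof. by move=> x y; apply/idP/idP => /asboolP/gc_sym/asboolP. Qed.
Fact rack_eq_trans : transitive rack_eq.
Proof. by move=> y x z /asboolP xy /asboolP /(gc_trans xy)/asboolP. Qed.

Definition rack_equiv := EquivRel rack_eq rack_eq_refl rack_eq_sym rack_eq_trans.

Definition presented_rack : Type := {eq_quot rack_equiv}.
HB.instance Definition _ := EqQuotient.on presented_rack.
HB.instance Definition _ := Choice.on presented_rack.

Implicit Types p q r : presented_rack.

Definition pr_op p q : presented_rack := \pi_presented_rack (repr p |> repr q).
Definition pr_inv p q : presented_rack :=
  \pi_presented_rack (repr p |>^-1 repr q).

Lemma pr_eqP (x y : free_rack g) :
  \pi_presented_rack x = \pi_presented_rack y <->
  generated_congruence (relation_pair R) x y.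
Proof. by split=> [/eqmodP/asboolP|/asboolP ?]; last exact/eqmodP. Qed.

Lemma repr_pi_cong (x : free_rack g) :
  generated_congruence (relation_pair R) (repr (\pi_presented_rack x)) x.
Proof. by apply/pr_eqP; rewrite reprK. Qed.

Lemma pr_opE (x y : free_rack g) :
  pr_op (\pi x) (\pi y) = \pi_presented_rack (x |> y).
Proof. exact/pr_eqP/gc_rop/repr_pi_cong/repr_pi_cong. Qed.

Lemma pr_invE (x y : free_rack g) :
  pr_inv (\pi x) (\pi y) = \pi_presented_rack (x |>^-1 y).
Proof. exact/pr_eqP/gc_rinv/repr_pi_cong/repr_pi_cong. Qed.

Fact pr_opK p q : pr_inv (pr_op p q) q = p.
Proof. by rewrite -[p]reprK -[q]reprK pr_opE pr_invE ropK. Qed.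
Fact pr_invK p q : pr_op (pr_inv p q) q = p.
Proof. by rewrite -[p]reprK -[q]reprK pr_invE pr_opE rinvK. Qed.
Fact pr_opD p q r : pr_op (pr_op p q) r = pr_op (pr_op p r) (pr_op q r).
Proof. by rewrite -[p]reprK -[q]reprK -[r]reprK !pr_opE ropD. Qed.

HB.instance Definition _ := isRack.Build presented_rack pr_opK pr_invK pr_opD.

Definition pr_gen (i : 'I_g) : presented_rack := \pi_presented_rack (fr_gen i).

Definition act_letter p (y : letter g) : presented_rack :=
  if y.2 then p |>^-1 pr_gen y.1 else p |> pr_gen y.1.

End PresentedRack.

(* The element \bar u x_i u \bar x_j of the free group. *)
Definition secondary g (r : primary_relation g) : free_group g :=
  let: (i, u, j) := r in (u^-1 * fg_gen i * u * (fg_gen j)^-1)%g.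

(** * Enumeration tables *)

(* Rows are numbered 1, ..., [nrows]: the generator x_i, numbered from 0 as
   [i : 'I_g], is row [i.+1]. Outside the rows, [tab] and [tau] take the value
   [None] and [rho] is the identity. *)
Record table (g : nat) (R : seq (primary_relation g)) := Table {
  nrows : nat;
  tab : nat -> letter g -> option nat;
  tau : nat -> option (presented_rack R);
  rho : nat -> nat
}.

Definition live g (R : seq (primary_relation g)) (E : table R) (i : nat) : bool :=
  (0 < i <= nrows E) && (rho E i == i).

Definition max_live g (R : seq (primary_relation g)) (E : table R) : nat :=
  \max_(1 <= i < (nrows E).+1 | live E i) i.

Definition is_iterate (f : nat -> nat) (i j : nat) : bool :=
  `[< exists t, j = iter t f i >].

Fact ex_iterate f i : exists j, is_iterate f i j.
Proof. by exists i; apply/asboolP; exists 0. Qed.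

Definition rep (f : nat -> nat) (i : nat) : nat := ex_minn (ex_iterate f i).

(** * The algorithms *)

(* Procedures with unbounded loops are big-step relations between the initial
   and the final table, so a final table exists only if they stop. [cletters]
   and [dletters] are the orders in which COINCIDENCE and ENUMERATE run through
   the letters. *)

Section Algorithms.
Variables (g : nat) (R : seq (primary_relation g)).
Variables (R2 : seq (free_group g)) (cletters dletters : seq (letter g)).

Notation table := (table R).
Implicit Types (E : table) (i j k l m n d : nat) (y : letter g) (s w : word g).

Definition init : table := {|
  nrows := g;
  tab := fun _ _ => None;
  tau := fun i => if i is i'.+1 then omap (@pr_gen g R) (insub i') else None;
  rho := id
|}.

Definition set_entry E i y (v : option nat) : table := {|
  nrows := nrows E;
  tab := fun j z => if (j == i) && (z == y) then v else tab E j z;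
  tau := tau E;
  rho := rho E
|}.

Definition set_rho E (f : nat -> nat) : table := {|
  nrows := nrows E; tab := tab E; tau := tau E; rho := f
|}.

Definition deduction E i y j : table :=
  set_entry (set_entry E i y (Some j)) j (bar y) (Some i).

Definition define E i y : table :=
  let n := (nrows E).+1 in
  let E' := deduction E i y n in {|
    nrows := n;
    tab := tab E';
    tau := fun j => if j == n then omap (fun p => act_letter p y) (tau E i)
                    else tau E j;
    rho := fun j => if j == n then n else rho E j
  |}.

Definition update E i : table :=
  set_rho E (fun j => if is_iterate (rho E) i j then rep (rho E) i
                      else rho E j).

Definition merge m n (EQ : table * seq nat) : table * seq nat :=
  let: (E, Q) := EQ in
  let mu := rep (rho E) m in
  let nu := rep (rho E) n in
  if mu == nu then (E, Q)
  else (set_rho E (fun j => if j == maxn mu nu then minn mu nu else rho E j),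
        rcons Q (maxn mu nu)).

Definition coincidence_step d (EQ : table * seq nat) y : table * seq nat :=
  let: (E, Q) := EQ in
  if tab E d y is Some e then
    let E1 := set_entry (set_entry E d y None) e (bar y) None in
    let delta := rep (rho E1) d in
    let E2 := update E1 d in
    let epsilon := rep (rho E2) e in
    let E3 := update E2 e in
    if tab E3 delta y is Some k then merge epsilon k (E3, Q)
    else if tab E3 epsilon (bar y) is Some k then merge delta k (E3, Q)
    else (deduction E3 delta y epsilon, Q)
  else (E, Q).

(* The second component of the state is the unprocessed part of the queue. *)
Inductive process_queue : table * seq nat -> table -> Prop :=
| process_nil E : process_queue (E, [::]) E
| process_cons E d Q E' :
    process_queue (foldl (coincidence_step d) (E, Q) cletters) E' ->
    process_queue (E, d :: Q) E'.

Definition coincidence E m n E' : Prop :=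
  process_queue (merge m n (E, [::])) E'.

(* The state k, y_f ... y_b, l of SCAN is represented by k, the word
   [:: y_f; ...; y_b] (empty if b < f) and l. *)
Fixpoint forward E k s : nat * word g :=
  if s is y :: s' then
    if tab E k y is Some k' then forward E k' s' else (k, s)
  else (k, s).

Definition backward E l s : nat * word g :=
  let: (l', s') := forward E l (word_inv s) in (l', word_inv s').

Definition trace E k s l : nat * word g * nat :=
  let: (k', s') := forward E k s in
  let: (l', s'') := backward E l s' in (k', s'', l').

Inductive scan : table -> nat -> word g -> nat -> table -> Prop :=
| scan_define E k s l k' y z s' l' E' :
    trace E k s l = (k', [:: y, z & s'], l') ->
    scan (define E k' y) k' [:: y, z & s'] l' E' ->
    scan E k s l E'
| scan_deduction E k s l k' y l' :
    trace E k s l = (k', [:: y], l') ->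
    scan E k s l (deduction E k' y l')
| scan_coincidence E k s l k' l' E' :
    trace E k s l = (k', [::], l') -> k' <> l' ->
    coincidence E k' l' E' ->
    scan E k s l E'
| scan_closed E k s l k' :
    trace E k s l = (k', [::], k') ->
    scan E k s l E.

Inductive scan_primary : table -> seq (primary_relation g) -> table -> Prop :=
| scan_primary_nil E : scan_primary E [::] E
| scan_primary_cons E (i : 'I_g) u (j : 'I_g) rs E1 E' :
    scan E (rep (rho E) i.+1) (fg_word u) (rep (rho E) j.+1) E1 ->
    scan_primary E1 rs E' ->
    scan_primary E ((i, u, j) :: rs) E'.

Inductive scan_secondary i : table -> seq (free_group g) -> table -> Prop :=
| scan_secondary_nil E : scan_secondary i E [::] E
| scan_secondary_break E (u : free_group g) us : ~~ live E i -> scan_secondary i E (u :: us) E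
| scan_secondary_cons E (u : free_group g) us E1 E' :
    live E i -> scan E i (fg_word u) i E1 ->
    scan_secondary i E1 us E' ->
    scan_secondary i E (u :: us) E'.

Definition fill_row E i : table :=
  if live E i then
    foldl (fun E' y => if tab E' i y is None then define E' i y else E')
          E dletters
  else E.

Inductive main_loop (M : nat) : table -> nat -> table -> nat -> Prop :=
| main_loop_stop E i :
    ~~ ((i <= max_live E) && (i <= M)) -> main_loop M E i E i
| main_loop_step E i E1 E' i' :
    (i <= max_live E) && (i <= M) ->
    scan_secondary i E R2 E1 ->
    main_loop M (fill_row E1 i) i.+1 E' i' ->
    main_loop M E i E' i'.

(* [Some E]: the table E is returned; [None]: run limit exceeded. *)
Definition enumerate (M : nat) (out : option table) : Prop :=
  exists E0 E i, [/\ scan_primary init R E0, main_loop M E0 1 E i &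
    out = if max_live E < i then Some E else None].

Definition completes (M : nat) : Prop := exists E, enumerate M (Some E).

End Algorithms.

(* Main.v *)
Require Import Defs.
From mathcomp Require Import all_boot.
From mathcomp Require Import boolp classical_sets cardinality filter.

(** Why the enumeration of a finite rack stops.

Every single procedure stops. A scan shortens the part of the word that is
still to be read whenever it defines a row ([scan_total]). A coincidence removes
one row from its queue at each round, and a row enters the queue only when it
stops being live, so the number of live rows plus the length of the queue
decreases ([process_queue_total]). Moreover no procedure forgets anything: an
entry k^y = l of the table remains an entry between the classes of k and l
([refines]). In particular, once a word has been scanned from a row to another
one, it leads from the class of the first to the class of the second for ever.

Suppose that the main loop runs for ever. The class of a given row can only
decrease, so it is eventually constant, and the rows that stay live for ever
carry a limit table. It is complete, since each of these rows is treated at some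
time: the free group acts on the permanent rows. In this action the primary
relations hold between the rows of the generators, and the secondary relations
fix every row. Send the symbol a^w to the row reached from the generator a by
the word w. Two symbols that are identified in the presented rack have the same
image; to see this one proves at the same time that the elements inner to them,
w^-1 a w, act in the same way on the permanent rows ([congruence_point]). As
every row can be reached from a generator inside the table, every permanent row
is obtained, hence a finite rack leaves only finitely many permanent rows.

At a late time the finitely many entries at permanent rows are final. All live
rows can be reached from generators by walking along such entries, so
that they are all permanent, and the largest live row is bounded. But the loop
goes on only while its counter is at most the largest live row: it stops
([endless_infinite]). *)

Set Implicit Arguments.
Unset Strict Implicit.
Unset Printing Implicit Defensive.

(** * Representatives under a decreasing map *)

Section Representatives.
Variable f : nat -> nat.
Hypothesis f_le : forall i, f i <= i.

Lemma rep_le_iter i t : rep f i <= iter t f i.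
Proof.
by rewrite /rep; case: ex_minnP => m _; apply; apply/asboolP; exists t.
Qed.

Lemma rep_iter i : exists t, rep f i = iter t f i.
Proof. by rewrite /rep; case: ex_minnP => m /asboolP. Qed.

Lemma rep_le i : rep f i <= i.
Proof. exact: (rep_le_iter i 0). Qed.

Lemma rep_fixed i : f (rep f i) = rep f i.
Proof.
apply/eqP; rewrite eqn_leq f_le /=; have [t def_r] := rep_iter i.
by rewrite {2}def_r (rep_le_iter i t.+1).
Qed.

Lemma fixed_rep i : f i = i -> rep f i = i.
Proof. by have [t ->] := rep_iter i; apply: iter_fix. Qed.

(** Any map that is constant along [f] and is the identity on its fixed points
is the representative map; this computes [rep] after a change of [f]. *)
Lemma rep_unique (h : nat -> nat) :
  (forall i, h (f i) = h i) -> (forall i, f i = i -> h i = i) ->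
  rep f =1 h.
Proof.
move=> hf h_fix i; rewrite -(h_fix _ (rep_fixed i)).
by have [t ->] := rep_iter i; elim: t => //= t IH; rewrite hf.
Qed.

Lemma rep_map i : rep f (f i) = rep f i.
Proof.
apply/eqP; rewrite eqn_leq; apply/andP; split.
  have [t def_r] := rep_iter i.
  by rewrite -[X in _ <= X]rep_fixed def_r -iterS iterSr rep_le_iter.
by have [t ->] := rep_iter (f i); rewrite -iterSr rep_le_iter.
Qed.

Lemma rep_rep i : rep f (rep f i) = rep f i.
Proof. exact/fixed_rep/rep_fixed. Qed.

Lemma rep_is_iterate i j : is_iterate f i j -> rep f j = rep f i.
Proof. by case/asboolP => t ->; elim: t => //= t IH; rewrite rep_map. Qed.

End Representatives.

(** * Well-formed tables *)

Section Tables.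
Variables (g : nat) (R : seq (primary_relation g)).
Notation table := (table R).
Implicit Types (E : table) (y z : letter g) (w : word g).

Definition row E i : bool := 0 < i <= nrows E.

Definition class E i : nat := rep (rho E) i.

Record well_formed E : Prop := WellFormed {
  wf_le : forall i, rho E i <= i;
  wf_pos : forall i, 0 < i -> 0 < rho E i;
  wf_out : forall i, ~~ row E i -> rho E i = i;
  wf_tab : forall i y j, tab E i y = Some j -> row E i;
  wf_bar : forall i y j, tab E i y = Some j -> tab E j (bar y) = Some i
}.

Lemma wf_tabr E i y j : well_formed E -> tab E i y = Some j -> row E j.
Proof. by move=> wfE /(wf_bar wfE)/(wf_tab wfE). Qed.

Lemma class_le E i : class E i <= i.
Proof. exact: rep_le. Qed.

Lemma class_fixed E i : well_formed E -> rho E (class E i) = class E i.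
Proof. by move=> wfE; apply: rep_fixed; apply: wf_le. Qed.

Lemma class_pos E i : well_formed E -> 0 < i -> 0 < class E i.
Proof.
move=> wfE i_gt0; rewrite /class; have [t ->] := rep_iter (rho E) i.
by elim: t => //= t /(wf_pos wfE).
Qed.

Lemma class_row E i : well_formed E -> row E i -> row E (class E i).
Proof.
move=> wfE /andP[i_gt0 i_le]; rewrite /row class_pos //=.
exact: leq_trans (class_le E i) i_le.
Qed.

Lemma class_idem E i : well_formed E -> class E (class E i) = class E i.
Proof. by move=> wfE; apply: rep_rep; apply: wf_le. Qed.

Lemma class_of_fixed E i : rho E i = i -> class E i = i.
Proof. exact: fixed_rep. Qed.

Lemma fixed_of_class E i : well_formed E -> class E i = i -> rho E i = i.
Proof. by move=> wfE <-; apply: class_fixed. Qed.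

Lemma liveE E i : well_formed E -> live E i = row E i && (class E i == i).
Proof.
move=> wfE; rewrite /live -/(row E i); congr (_ && _).
by apply/eqP/eqP => [/class_of_fixed|/(fixed_of_class wfE)].
Qed.

Lemma bar_neq y : (bar y == y) = false.
Proof. by case: y => a b; rewrite /bar xpair_eqE eqxx /=; case: b. Qed.

Lemma bar_inj : injective (@bar g).
Proof. exact: can_inj (@barK g). Qed.

(** ** Walks *)

Definition walk E (k : nat) w : option nat :=
  foldl (fun o y => obind (fun i => tab E i y) o) (Some k) w.

Lemma walk_cons E k y w :
  walk E k (y :: w) = obind (fun i => walk E i w) (tab E k y).
Proof.
rewrite /walk /=; case: (tab E k y) => [//|] /=.
by elim: w => //= z w IH.
Qed.

Lemma walk_cat E k u v : walk E k (u ++ v) = obind (fun i => walk E i v) (walk E k u).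
Proof.
elim: u k => // y u IH k; rewrite cat_cons !walk_cons.
by case: (tab E k y) => //= i; apply: IH.
Qed.

Lemma walk_catS E k u v i : walk E k u = Some i -> walk E k (u ++ v) = walk E i v.
Proof. by move=> ku; rewrite walk_cat ku. Qed.

Lemma word_inv_cat (u v : word g) : word_inv (u ++ v) = word_inv v ++ word_inv u.
Proof. by rewrite /word_inv map_cat rev_cat. Qed.

Lemma walk_inv E k w l : well_formed E -> walk E k w = Some l ->
  walk E l (word_inv w) = Some k.
Proof.
move=> wfE; elim: w k => [k [->] //|y w IH k]; rewrite walk_cons.
case kE: (tab E k y) => [i|//] /= /IH {}IH.
rewrite -cat1s word_inv_cat (walk_catS _ IH) walk_cons /=.
by rewrite (wf_bar wfE kE).
Qed.

(** Outside the processing of coincidences, merged rows have been removed from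
the table; this is what makes a walk from a live row stay among live rows. *)
Definition settled E : Prop :=
  well_formed E /\ forall i y j, tab E i y = Some j -> rho E i = i.

Lemma settled_tab E i y j : settled E -> tab E i y = Some j -> live E i && live E j.
Proof.
move=> [wfE stE] iE; rewrite /live -!/(row _ _).
rewrite (wf_tab wfE iE) (wf_tabr wfE iE) (stE _ _ _ iE) eqxx.
by rewrite (stE _ _ _ (wf_bar wfE iE)) eqxx.
Qed.

Lemma settled_walk E i w j : settled E -> walk E i w = Some j -> live E i -> live E j.
Proof.
move=> stE; elim: w i => [i [->] //|y w IH i]; rewrite walk_cons.
by case iE: (tab E i y) => [k|//] /= /IH kj _; case/andP: (settled_tab stE iE) => _.
Qed.

(** ** Refinement *)

(** Collapsing rows may move an entry, but it never loses the information that
the entry carried: this is the order in which every procedure goes up. It is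
stated up to classes of rows so that it also holds between the steps of a
coincidence, when some entries still sit at merged rows. *)
Record refines E E' : Prop := Refines {
  ref_nrows : nrows E <= nrows E';
  ref_class : forall i, class E' (class E i) = class E' i;
  ref_tab : forall i y j, tab E i y = Some j -> exists i' j',
    [/\ tab E' i' y = Some j', class E' i' = class E' i & class E' j' = class E' j]
}.

Lemma refines_refl E : well_formed E -> refines E E.
Proof.
by move=> wfE; split=> // [i|i y j iE]; [exact: class_idem|exists i, j].
Qed.

Lemma refines_trans E1 E2 E3 : refines E1 E2 -> refines E2 E3 -> refines E1 E3.
Proof.
move=> r12 r23; split; first exact: leq_trans (ref_nrows r12) (ref_nrows r23).
  by move=> i; rewrite -(ref_class r23 (class E1 i)) (ref_class r12) (ref_class r23).
move=> i y j /(ref_tab r12)[i' [j' [/(ref_tab r23)[i'' [j'' [e3 ci cj]]] ci' cj']]].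
exists i'', j''; split=> //; first by rewrite ci -(ref_class r23) ci' (ref_class r23).
by rewrite cj -(ref_class r23) cj' (ref_class r23).
Qed.

Lemma refines_tab E E' i y j : settled E' -> refines E E' -> tab E i y = Some j ->
  tab E' (class E' i) y = Some (class E' j).
Proof.
move=> [wfE' stE'] rE /(ref_tab rE)[i' [j' [e' <- <-]]].
rewrite (class_of_fixed (stE' _ _ _ e')).
by rewrite (class_of_fixed (stE' _ _ _ (wf_bar wfE' e'))).
Qed.

Lemma refines_walk E E' i w j : settled E' -> refines E E' -> walk E i w = Some j ->
  walk E' (class E' i) w = Some (class E' j).
Proof.
move=> stE' rE; elim: w i => [i [->] //|y w IH i]; rewrite !walk_cons.
by case iE: (tab E i y) => [k|//] /= /IH kj; rewrite (refines_tab stE' rE iE).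
Qed.

(** If one entry and its inverse are dropped, it suffices to exhibit an entry
that stands for them. *)
Lemma refines_replace E E' d y e p q :
  well_formed E -> well_formed E' -> nrows E <= nrows E' ->
  (forall i, class E' (class E i) = class E' i) ->
  tab E d y = Some e ->
  (forall i z j, tab E i z = Some j -> (i, z) != (d, y) -> (i, z) != (e, bar y) ->
     tab E' i z = Some j) ->
  tab E' p y = Some q -> class E' p = class E' d -> class E' q = class E' e ->
  refines E E'.
Proof.
move=> wfE wfE' le_n cE dE keep pE' cp cq; split=> // i z j iE.
have [[ei ez]|nd] := altP ((i, z) =P (d, y)).
  by exists p, q; move: iE; rewrite ei ez dE => -[<-].
have [[ei ez]|ne] := altP ((i, z) =P (e, bar y)).
  exists q, p; move: iE; rewrite ei ez (wf_bar wfE dE) => -[<-].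
  by rewrite (wf_bar wfE' pE').
by exists i, j; rewrite (keep _ _ _ iE).
Qed.

(** ** Adding and removing entries *)

Lemma tab_deduction E i y j k z : tab (deduction E i y j) k z =
  if (k == j) && (z == bar y) then Some i
  else if (k == i) && (z == y) then Some j else tab E k z.
Proof. by []. Qed.

Lemma wf_deduction E i y j : well_formed E -> row E i -> row E j ->
  tab E i y = None -> tab E j (bar y) = None -> well_formed (deduction E i y j).
Proof.
move=> wfE ri rj iN jN; split; try by [exact: (wf_le wfE)|exact: (wf_pos wfE)|exact: (wf_out wfE)].
  move=> k z l; rewrite tab_deduction.
  case: ifP => [/andP[/eqP-> _] //|_]; case: ifP => [/andP[/eqP-> _] //|_].
  exact: wf_tab.
move=> k z l; rewrite !tab_deduction.
case: ifP => [/andP[/eqP-> /eqP->] [<-]|nj].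
  by rewrite barK eqxx andbC eq_sym bar_neq /= !eqxx.
case: ifP => [/andP[/eqP-> /eqP->] [<-]|ni kE]; first by rewrite !eqxx.
have lE := wf_bar wfE kE.
case: ifP => [/andP[/eqP el /eqP ez]|_].
  by move: lE; rewrite el ez jN.
case: ifP => [/andP[/eqP el /eqP ez]|_ //].
by move: lE; rewrite el ez iN.
Qed.

Lemma settled_deduction E i y j : settled E -> live E i -> live E j ->
  tab E i y = None -> tab E j (bar y) = None -> settled (deduction E i y j).
Proof.
move=> [wfE stE] /andP[ri /eqP fi] /andP[rj /eqP fj] iN jN.
split; first exact: wf_deduction.
move=> k z l; rewrite tab_deduction.
case: ifP => [/andP[/eqP-> _] //|_]; case: ifP => [/andP[/eqP-> _] //|_].
exact: stE.
Qed.

Lemma refines_deduction E i y j : well_formed E ->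
  tab E i y = None -> tab E j (bar y) = None -> refines E (deduction E i y j).
Proof.
move=> wfE iN jN; split=> // [k|k z l kE]; first exact: (class_idem k wfE).
exists k, l; rewrite tab_deduction.
case: ifP => [/andP[/eqP ek /eqP ez]|_]; first by move: kE; rewrite ek ez jN.
by case: ifP => [/andP[/eqP ek /eqP ez]|_ //]; move: kE; rewrite ek ez iN.
Qed.

Definition erase E d y e : table :=
  set_entry (set_entry E d y None) e (bar y) None.

Lemma tab_erase E d y e k z j : (tab (erase E d y e) k z = Some j) <->
  [/\ tab E k z = Some j, (k, z) != (d, y) & (k, z) != (e, bar y)].
Proof.
rewrite [_ == (d, y)]xpair_eqE [_ == (e, bar y)]xpair_eqE /=.
by case: (_ && _) => /=; [|case: (_ && _)]; split=> // -[].
Qed.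

Lemma wf_erase E d y e : well_formed E -> tab E d y = Some e ->
  well_formed (erase E d y e).
Proof.
move=> wfE dE; split; try by [exact: (wf_le wfE)|exact: (wf_pos wfE)|exact: (wf_out wfE)].
  by move=> k z l /tab_erase[/(wf_tab wfE)].
move=> k z l /tab_erase[kE nd ne]; have lE := wf_bar wfE kE.
apply/tab_erase; split=> //.
  apply: contraNneq ne => -[el ez]; apply/eqP; congr (_, _); last by rewrite -ez barK.
  by move: lE; rewrite el ez dE => -[].
apply: contraNneq nd => /pair_equal_spec[el /bar_inj ez]; apply/eqP; congr (_, _) => //.
by move: lE; rewrite el ez (wf_bar wfE dE) => -[].
Qed.

Lemma rho_define E i y : well_formed E -> rho (define E i y) = rho E.
Proof.
move=> wfE; apply/funext => j /=; case: eqP => [->|//].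
by rewrite wf_out // /row ltnn.
Qed.

Lemma tab_new_row E y : well_formed E -> tab E (nrows E).+1 y = None.
Proof.
by move=> wfE; case nE: (tab _ _ _) => [j|//]; have := wf_tab wfE nE; rewrite /row ltnn.
Qed.

Lemma tab_define E i y : tab (define E i y) = tab (deduction E i y (nrows E).+1).
Proof. by []. Qed.

Lemma class_define E i y k : well_formed E -> class (define E i y) k = class E k.
Proof. by move=> wfE; rewrite /class rho_define. Qed.

Lemma live_define E i y k : well_formed E -> live E k -> live (define E i y) k.
Proof.
move=> wfE /andP[/andP[k_gt0 k_le] fk].
by rewrite /live rho_define // k_gt0 (leq_trans k_le) /=.
Qed.

Lemma settled_define E i y : settled E -> live E i -> tab E i y = None ->
  settled (define E i y).
Proof.
set n := (nrows E).+1 => -[wfE stE] /andP[/andP[i_gt0 i_le] /eqP fi] iN.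
have [wfR wfP wfO wfT wfB] := wfE.
have nN z : tab E n z = None by exact: tab_new_row.
have fn : rho E n = n by rewrite wfO // /row ltnn.
(* Once the new row has been counted, the definition is a deduction. *)
pose E' := Table n (tab E) (tau E) (rho E).
have wfE' : well_formed E'.
  split=> //= k; first by move=> nk; apply: wfO; apply: contra nk => /andP[k0 kn];
    rewrite /row k0 /= (leq_trans kn).
  by move=> z j /wfT /andP[k0 kn]; rewrite /row k0 (leq_trans kn) /=.
have [] : settled (deduction E' i y n).
  apply: settled_deduction => //; rewrite /live /= ?fi ?fn ?eqxx ?i_gt0 ?leqnn //=.
  by rewrite leqW.
case=> dR dP dO dT dB dS; rewrite /settled; split; last by rewrite rho_define.
by split; rewrite ?rho_define.
Qed.

Lemma refines_define E i y : well_formed E -> tab E i y = None ->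
  refines E (define E i y).
Proof.
move=> wfE iN; split=> [|k|k z j kE] /=; first exact: leqnSn.
  by rewrite !class_define // class_idem.
have /ref_tab/(_ k z j kE) := refines_deduction wfE iN (tab_new_row _ wfE).
by case=> i' [j' []]; exists i', j'; rewrite !class_define.
Qed.

(** * Coincidences *)

(** ** Path compression and merging *)

Section Update.
Variables (E : table) (i : nat).
Hypothesis wfE : well_formed E.

Lemma rho_update j : rho (update E i) j =
  if is_iterate (rho E) i j then class E j else rho E j.
Proof.
rewrite /=; case: ifP => // ij.
by rewrite /class (rep_is_iterate (wf_le wfE) ij).
Qed.

Lemma wf_update : well_formed (update E i).
Proof.
split=> [j|j j_gt0|j nj|j y k|j y k]; rewrite ?rho_update; last 2 first.
- exact: (wf_tab wfE).
- exact: (wf_bar wfE).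
- by case: ifP => _; [exact: class_le|exact: (wf_le wfE)].
- by case: ifP => _; [exact: class_pos|exact: (wf_pos wfE)].
have fj : rho E j = j by exact: (wf_out wfE).
by case: ifP => _ //; apply: class_of_fixed.
Qed.

Lemma class_update : class (update E i) =1 class E.
Proof.
apply: (rep_unique (wf_le wf_update)) => j; rewrite rho_update.
  case: ifP => _; first exact: class_idem.
  exact/rep_map/(wf_le wfE).
by case: ifP => _ //; apply: class_of_fixed.
Qed.

End Update.

Lemma fixedE E i : well_formed E -> (rho E i == i) = (class E i == i).
Proof.
by move=> wfE; apply/eqP/eqP => [/class_of_fixed|/(fixed_of_class wfE)].
Qed.

Section Union.
Variables (E : table) (a b : nat).
Hypotheses (wfE : well_formed E) (ra : row E a) (rb : row E b).
Hypotheses (fa : rho E a = a) (fb : rho E b = b) (lt_ab : a < b).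

Definition union : table := set_rho E (fun j => if j == b then a else rho E j).

Lemma wf_union : well_formed union.
Proof.
split=> [j|j j_gt0|j nj|j y k|j y k] /=; last 2 first.
- exact: (wf_tab wfE).
- exact: (wf_bar wfE).
- by case: eqP => [->|_]; [exact: ltnW|exact: (wf_le wfE)].
- by case: eqP => _; [case/andP: ra|exact: (wf_pos wfE)].
case: eqP => [ej|_]; last exact: (wf_out wfE).
by move: nj; rewrite ej (_ : row union b = row E b) // rb.
Qed.

Lemma class_union j : class union j = if class E j == b then a else class E j.
Proof.
have ca : class E a = a by exact: class_of_fixed.
pose h k := if class E k == b then a else class E k.
apply: (rep_unique (wf_le wf_union) (h := h)) => {}j; rewrite /h /=; case: (j =P b) => [->|jb].
- by rewrite ca (class_of_fixed fb) eqxx ltn_eqF.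
- by rewrite /class (rep_map (wf_le wfE)).
- by move=> ab; move: lt_ab; rewrite ab ltnn.
- by move=> /class_of_fixed ->; case: eqP jb.
Qed.

End Union.

(** ** Progress of the coincidence procedure *)

Definition nlive E : nat := count (live E) (iota 1 (nrows E)).

Lemma nlive_le E E' : nrows E' = nrows E ->
  (forall i, rho E' i = i -> rho E i = i) -> nlive E' <= nlive E.
Proof.
move=> eq_n fixE; rewrite /nlive eq_n; apply: sub_count => i.
by rewrite /live eq_n => /andP[-> /eqP/fixE ->] /=.
Qed.

Lemma nlive_lt E E' b : nrows E' = nrows E ->
  (forall i, rho E' i = i -> rho E i = i) ->
  row E b -> rho E b = b -> rho E' b <> b -> nlive E' < nlive E.
Proof.
move=> eq_n fixE rb fb nb; rewrite /nlive eq_n.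
have sub : subpred (live E') (live E).
  by move=> i; rewrite /live eq_n => /andP[-> /eqP/fixE ->] /=.
rewrite -[X in _ < X]size_filter -(count_predC (live E')) !count_filter.
set s := iota _ _.
rewrite (@eq_count _ (predI (live E') (live E)) (live E')); last first.
  by move=> i /=; case: (boolP (live E' i)) => // /sub.
rewrite -addn1 leq_add2l -has_count; apply/hasP; exists b.
  by rewrite mem_iota add1n ltnS.
rewrite /= /live -/(row E b) rb fb eqxx andbT.
by rewrite andbT; apply: contra_notN nb => /andP[_ /eqP].
Qed.

(** Each processed element of the queue leaves it, and each new one stops being
live: this is why the number of live rows plus the length of the queue measures
what remains to be done. *)
Record advances (S S' : table * seq nat) : Prop := Advances {
  adv_nrows : nrows S'.1 = nrows S.1;
  adv_sub : {subset S.2 <= S'.2};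
  adv_new : forall i, i \in S'.2 -> i \in S.2 \/ rho S'.1 i <> i;
  adv_fixed : forall i, rho S'.1 i = i -> rho S.1 i = i;
  adv_merged : forall i, rho S.1 i = i -> rho S'.1 i = i \/ i \in S'.2;
  adv_measure : nlive S'.1 + size S'.2 <= nlive S.1 + size S.2
}.

Lemma advances_trans S1 S2 S3 : advances S1 S2 -> advances S2 S3 -> advances S1 S3.
Proof.
case=> n12 s12 w12 f12 m12 l12 [n23 s23 w23 f23 m23 l23]; split.
- by rewrite n23.
- by move=> i /s12/s23.
- move=> i /w23[/w12[?|ni]|?]; [by left| |by right].
  by right=> /f23.
- by move=> i /f23/f12.
- by move=> i /m12[/m23|/s23]; [|right].
- exact: leq_trans l12.
Qed.

Lemma advances_same_classes E E' Q : well_formed E -> well_formed E' ->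
  nrows E' = nrows E -> class E' =1 class E -> advances (E, Q) (E', Q).
Proof.
move=> wfE wfE' eq_n eq_c.
have eq_f i : rho E' i = i <-> rho E i = i.
  by split=> /eqP h; apply/eqP; move: h; rewrite !fixedE // eq_c.
split=> //= [i|i /eq_f|i /eq_f|] //; try by left.
by rewrite leq_add2r nlive_le // => j /eq_f.
Qed.

Lemma merge_spec E Q m n E' Q' :
  well_formed E -> row E m -> row E n -> Defs.merge m n (E, Q) = (E', Q') ->
  [/\ well_formed E', tab E' = tab E, class E' m = class E' n,
      forall i, class E' (class E i) = class E' i & advances (E, Q) (E', Q')].
Proof.
move=> wfE rm rn; rewrite /Defs.merge -!/(class E _).
set mu := class E m; set nu := class E n.
have [eq_mn [<- <-]|] := eqVneq mu nu.
  split=> //; first by move=> i; apply: class_idem.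
  exact: advances_same_classes.
set a := minn mu nu; set b := maxn mu nu => neq [<- <-].
have lt_ab : a < b by rewrite /a /b; case: (ltngtP mu nu) neq.
have fmu : rho E mu = mu by exact: class_fixed.
have fnu : rho E nu = nu by exact: class_fixed.
have rmu : row E mu by exact: class_row.
have rnu : row E nu by exact: class_row.
have [fa ra] : rho E a = a /\ row E a by rewrite /a /minn; case: ifP.
have [fb rb] : rho E b = b /\ row E b by rewrite /b /maxn; case: ifP.
rewrite -/(union E a b); have wfU := wf_union wfE ra rb lt_ab.
have cU := class_union wfE ra rb fa fb lt_ab.
have fU i : rho (union E a b) i = i <-> rho E i = i /\ i <> b.
  rewrite /=; case: eqP => [->|ib]; last by split=> [|[]].
  by split=> [ab|[_ /(_ erefl)] //]; rewrite ab ltnn in lt_ab.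
split=> //.
- rewrite !cU -/mu -/nu; case: (ltngtP mu nu) neq => // lt _.
    by rewrite /b /a (maxn_idPr (ltnW lt)) (minn_idPl (ltnW lt)) eqxx ltn_eqF.
  by rewrite /b /a (maxn_idPl (ltnW lt)) (minn_idPr (ltnW lt)) eqxx ltn_eqF.
- by move=> i; rewrite !cU class_idem.
split=> //.
- by move=> i iQ; rewrite mem_rcons inE iQ orbT.
- move=> i; rewrite mem_rcons inE => /orP[/eqP->|]; [right|by left].
  by move/fU => [].
- by move=> i /fU[].
- move=> i fi; have [->|/eqP ib] := eqVneq i b; last by left; apply/fU.
  by right; rewrite mem_rcons inE eqxx.
rewrite /= size_rcons addnS -addSn leq_add2r.
by apply: (@nlive_lt _ _ b) => // [i /fU[]|/fU[]].
Qed.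

(** ** One entry of a merged row *)

(** The dropped entry of [d] survives between the classes of its ends: it is put
back there, unless one of these two places is occupied, in which case the merge
identifies the missing end with the end of the entry found. The last clause says
that [d], being merged, never receives an entry. *)
Lemma coincidence_step_spec E Q d y E' Q' :
  well_formed E -> rho E d <> d -> coincidence_step d (E, Q) y = (E', Q') ->
  [/\ well_formed E', refines E E', advances (E, Q) (E', Q') &
      forall i z j, tab E' i z = Some j ->
        tab E i z = Some j /\ (i, z) <> (d, y) \/ rho E i = i].
Proof.
move=> wfE nd; rewrite /coincidence_step; case dE: (tab E d y) => [e|]; last first.
  case=> <- <-; split=> //; first exact: refines_refl.
    exact: advances_same_classes.
  by move=> i z j iE; left; split=> // -[ei ez]; rewrite ei ez dE in iE.
rewrite -/(erase E d y e).
have wf1 : well_formed (erase E d y e) by exact: wf_erase.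
set E1 := erase E d y e in wf1 *.
have wf2 : well_formed (update E1 d) by exact: wf_update.
have c2 : class (update E1 d) =1 class E by move=> i; rewrite class_update.
set E2 := update E1 d in wf2 c2 *.
have wf3 : well_formed (update E2 e) by exact: wf_update.
have c3 : class (update E2 e) =1 class E by move=> i; rewrite class_update.
set E3 := update E2 e in wf3 c3 *.
rewrite -[rep (rho E1) d]/(class E d) -[rep (rho E2) e]/(class E2 e) c2.
set delta := class E d; set epsilon := class E e.
have rd : row E d by exact: wf_tab dE.
have re : row E e by exact: wf_tabr dE.
have fdelta : rho E delta = delta by exact: class_fixed.
have fepsilon : rho E epsilon = epsilon by exact: class_fixed.
have rdelta : row E3 delta by exact: (class_row wfE rd).
have repsilon : row E3 epsilon by exact: (class_row wfE re).
have adv3 : advances (E, Q) (E3, Q) by exact: advances_same_classes.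
have keep i z j : tab E i z = Some j -> (i, z) != (d, y) ->
  (i, z) != (e, bar y) -> tab E3 i z = Some j.
  by move=> iE n1 n2; apply/tab_erase.
have left_tab i z j : tab E3 i z = Some j -> tab E i z = Some j /\ (i, z) <> (d, y).
  by case/tab_erase => iE /eqP.
have after_merge p q k l : Defs.merge p q (E3, Q) = (E', Q') ->
  row E3 p -> row E3 q -> tab E3 k y = Some l ->
  ((forall i, class E' (class E i) = class E' i) -> class E' p = class E' q ->
    class E' k = class E' d /\ class E' l = class E' e) ->
  [/\ well_formed E', refines E E', advances (E, Q) (E', Q') &
      forall i z j, tab E' i z = Some j ->
        tab E i z = Some j /\ (i, z) <> (d, y) \/ rho E i = i].
  move=> merged rp rq kE cls.
  have [wf' tE' eq_pq cE' adv'] := merge_spec wf3 rp rq merged.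
  have {}cE' i : class E' (class E i) = class E' i by rewrite -c3 cE'.
  have [ck cl] := cls cE' eq_pq.
  have adv : advances (E, Q) (E', Q') by exact: advances_trans adv'.
  split=> //; last by move=> i z j; rewrite tE' => /left_tab; left.
  apply: (refines_replace wfE wf' _ cE' dE _ _ ck cl); rewrite ?tE' //.
  by rewrite -(adv_nrows adv).
case deltaE: (tab E3 delta y) => [k|].
  move=> merged; have rk : row E3 k by exact: wf_tabr deltaE.
  by apply: (after_merge _ _ _ _ merged repsilon rk deltaE) => cE' <-; split; apply: cE'.
case epsilonE: (tab E3 epsilon (bar y)) => [k|].
  move=> merged; have rk : row E3 k by exact: wf_tabr epsilonE.
  have kE : tab E3 k y = Some epsilon by rewrite -[y]barK (wf_bar wf3 epsilonE).
  by apply: (after_merge _ _ _ _ merged rdelta rk kE) => cE' <-; split; apply: cE'.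
case=> <- <-; have wf4 : well_formed (deduction E3 delta y epsilon).
  exact: wf_deduction.
have c4 : class (deduction E3 delta y epsilon) =1 class E by [].
split=> //.
- apply: (refines_replace wfE wf4 _ _ dE (p := delta) (q := epsilon)) => //.
  + by move=> i; rewrite !c4 class_idem.
  + move=> i z j iE n1 n2; rewrite tab_deduction.
    have kE := keep _ _ _ iE n1 n2.
    case: ifP => [/andP[/eqP ei /eqP ez]|_]; first by rewrite ei ez epsilonE in kE.
    by case: ifP => [/andP[/eqP ei /eqP ez]|_ //]; rewrite ei ez deltaE in kE.
  + rewrite tab_deduction !eqxx andbC; case: eqP => // ey.
    by have := bar_neq y; rewrite -ey eqxx.
  + by rewrite !c4 class_idem.
  + by rewrite !c4 class_idem.
- exact: advances_same_classes.
move=> i z j; rewrite tab_deduction.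
case: ifP => [/andP[/eqP-> _] _|_]; first by right.
case: ifP => [/andP[/eqP-> _] _|_ /left_tab]; [by right|by left].
Qed.

(** ** Termination of coincidences *)

Section Procedures.
Variable cletters : seq (letter g).
Hypothesis cletters_all : forall y, y \in cletters.

Lemma coincidence_row_spec E Q d ys E' Q' :
  well_formed E -> rho E d <> d ->
  foldl (coincidence_step d) (E, Q) ys = (E', Q') ->
  [/\ well_formed E', refines E E', advances (E, Q) (E', Q') &
      forall i z j, tab E' i z = Some j ->
        tab E i z = Some j /\ (i = d -> z \notin ys) \/ rho E i = i].
Proof.
elim: ys E Q => [|y ys IH] E Q wfE nd.
  case=> <- <-; split=> //; first exact: refines_refl.
    exact: advances_same_classes.
  by move=> i z j iE; left.
have -> : foldl (coincidence_step d) (E, Q) (y :: ys) =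
  foldl (coincidence_step d) (coincidence_step d (E, Q) y) ys by [].
case step: (coincidence_step d (E, Q) y) => [E1 Q1].
have [wf1 ref1 adv1 tab1] := coincidence_step_spec wfE nd step.
have nd1 : rho E1 d <> d by move/(adv_fixed adv1).
move=> /(IH _ _ wf1 nd1)[wf' ref' adv' tab'].
split=> //; [exact: refines_trans ref'|exact: advances_trans adv'|].
move=> i z j /tab'[[/tab1[[iE neq]|]]|/(adv_fixed adv1)]; [|by right|by right].
move=> nin; left; split=> // ei; rewrite inE negb_or nin // andbT.
by apply/eqP => ez; apply: neq; rewrite ei ez.
Qed.

(** Rows of the queue are the only merged rows that still have entries, so an
empty queue means that the table is settled again. *)
Lemma process_queue_total E Q : well_formed E ->
  {in Q, forall d, rho E d <> d} ->
  (forall i y j, tab E i y = Some j -> rho E i = i \/ i \in Q) ->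
  exists E', [/\ process_queue cletters (E, Q) E', settled E', refines E E' &
    nrows E' = nrows E].
Proof.
have [n] := ubnP (nlive E + size Q); elim: n E Q => // n IH E [|d Q] lt_n wfE dead tabE.
  exists E; split=> //; [exact: process_nil| |exact: refines_refl].
  by split=> // i y j /tabE[].
case row_d: (foldl (coincidence_step d) (E, Q) cletters) => [E1 Q1].
have nd : rho E d <> d by apply: dead; rewrite inE eqxx.
have [wf1 ref1 adv1 tab1] := coincidence_row_spec wfE nd row_d.
have [||||E' [pqE' stE' refE' nE']] := IH E1 Q1.
- by rewrite (leq_ltn_trans (adv_measure adv1)) // -ltnS -addnS.
- exact: wf1.
- move=> i /(adv_new adv1)[iQ|//]; have : rho E i <> i by apply: dead; rewrite inE iQ orbT.
  by move=> ni /(adv_fixed adv1).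
- move=> i y j /tab1[[/tabE[/(adv_merged adv1)//|iQ] nin]|/(adv_merged adv1) //].
  right; apply: (adv_sub adv1); move: iQ; rewrite inE => /orP[/eqP/nin|//].
  by rewrite cletters_all.
exists E'; split=> //; [|exact: refines_trans refE'|].
  by apply: process_cons; rewrite row_d.
by rewrite nE' (adv_nrows adv1).
Qed.

Lemma coincidence_total E m n : settled E -> live E m -> live E n ->
  exists E', [/\ coincidence cletters E m n E', settled E', refines E E',
    nrows E' = nrows E & class E' m = class E' n].
Proof.
move=> [wfE stE] /andP[rm _] /andP[rn _].
case merged: (Defs.merge m n (E, [::])) => [E1 Q1].
have [wf1 tE1 eq_mn c1 adv1] := merge_spec wfE rm rn merged.
have [||E' [pqE' stE' refE' nE']] := process_queue_total wf1 (Q := Q1).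
- by move=> i /(adv_new adv1)[].
- by move=> i y j; rewrite tE1 => /stE /(adv_merged adv1).
have ref1 : refines E E1.
  split=> [||i y j iE]; [by rewrite (adv_nrows adv1)|exact: c1|].
  by exists i, j; rewrite tE1.
exists E'; split=> //; [by rewrite /coincidence merged|exact: refines_trans refE'| |].
  by rewrite nE' (adv_nrows adv1).
by rewrite -(ref_class refE' m) eq_mn (ref_class refE').
Qed.

(** * Scanning *)

(** Every row can be reached from a generator inside the table. This is what
will identify the live rows once the table has stabilised around the
generators. *)
Definition spanned E : Prop := forall i, row E i ->
  exists (a : 'I_g) w, walk E (class E a.+1) w = Some (class E i).

Definition valid E : Prop := [/\ settled E, g <= nrows E & spanned E].

(** Walks are preserved by refinement, so only new rows have to be attached. *)
Lemma valid_refines E E' : valid E -> settled E' -> refines E E' ->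
  (forall i, row E' i -> ~~ row E i ->
     exists j y, row E j /\ tab E' (class E' j) y = Some (class E' i)) -> valid E'.
Proof.
move=> [stE le_g spE] stE' refE new; split=> //.
  exact: leq_trans (ref_nrows refE).
have old i : row E i -> exists (a : 'I_g) w, walk E' (class E' a.+1) w = Some (class E' i).
  move=> /spE[a [w aw]]; exists a, w.
  by have := refines_walk stE' refE aw; rewrite !(ref_class refE).
move=> i ri; have [/old //|/(new _ ri)[j [y [/old[a [w aw]] jE]]]] := boolP (row E i).
by exists a, (rcons w y); rewrite -cats1 (walk_catS _ aw) walk_cons jE.
Qed.

Lemma valid_same_rows E E' : valid E -> settled E' -> refines E E' ->
  nrows E' = nrows E -> valid E'.
Proof.
move=> vE stE' refE eq_n; apply: (valid_refines vE) => // i.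
by rewrite /row eq_n => ->.
Qed.

Lemma tab_define_new E i y : tab (define E i y) i y = Some (nrows E).+1.
Proof.
rewrite tab_define tab_deduction !eqxx andbC; case: eqP => // ey.
by have := bar_neq y; rewrite -ey eqxx.
Qed.

Lemma valid_define E i y : valid E -> live E i -> tab E i y = None ->
  valid (define E i y).
Proof.
move=> vE; have [stE _ _] := vE => li iN; have [wfE _] := stE.
have stE' := settled_define stE li iN.
apply: (valid_refines vE stE'); first exact: refines_define.
move=> k; rewrite /row [nrows (define _ _ _)]/= => /andP[-> k_le].
move: k_le; rewrite leq_eqVlt ltnS => /orP[/eqP-> _|-> //].
have /andP[ri /eqP fi] := li; exists i, y; split=> //.
have -> : class (define E i y) i = i by rewrite class_define // class_of_fixed.
by rewrite tab_define_new class_define // class_of_fixed // (wf_out wfE) // /row ltnn.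
Qed.

Lemma forward_spec E k s k' s' : forward E k s = (k', s') ->
  exists u, [/\ s = u ++ s', walk E k u = Some k' &
    forall y t, s' = y :: t -> tab E k' y = None].
Proof.
elim: s k => [|y s IH] k /=; first by case=> <- <-; exists [::].
case kE: (tab E k y) => [i|] => [/IH[u [-> iu stop]]|[<- <-]].
  by exists (y :: u); rewrite walk_cons kE.
by exists [::]; split=> // z t [<-].
Qed.

(** The last two clauses are what allows the procedure to write at both ends of
the unread part without overwriting an entry. *)
Lemma trace_spec E k s l k' m l' : trace E k s l = (k', m, l') ->
  exists u v, [/\ s = u ++ m ++ v, walk E k u = Some k',
    walk E l (word_inv v) = Some l',
    forall y t, m = y :: t -> tab E k' y = None &
    forall y t, m = rcons t y -> tab E l' (bar y) = None].
Proof.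
rewrite /trace /backward; case fw: (forward E k s) => [k1 s1].
case bw: (forward E l (word_inv s1)) => [l1 s2] [<- <- <-].
have [u [-> ku stop_u]] := forward_spec fw.
have [v [def_s1 lv stop_v]] := forward_spec bw.
have {}def_s1 : s1 = word_inv s2 ++ word_inv v.
  by rewrite -word_inv_cat -def_s1 word_invK.
exists u, (word_inv v); rewrite -def_s1 word_invK; split=> // y t.
  by move=> def_m; apply: (stop_u _ (t ++ word_inv v)); rewrite def_s1 def_m.
move=> def_m; apply: (stop_v _ (word_inv t)).
by rewrite -[s2]word_invK def_m -cats1 word_inv_cat.
Qed.

Lemma forward_cons E k y s : forward E k (y :: s) =
  if tab E k y is Some i then forward E i s else (k, y :: s).
Proof. by []. Qed.

Lemma size_forward E k s : size (forward E k s).2 <= size s.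
Proof. by elim: s k => //= y s IH k; case: (tab E k y) => [i|] //=; apply: leqW. Qed.

Lemma size_trace E k s l : size (trace E k s l).1.2 <= size (forward E k s).2.
Proof.
rewrite /trace /backward; case: (forward E k s) => [k1 s1].
have := size_forward E l (word_inv s1).
case: (forward E l _) => [l1 s2] /=.
by rewrite /word_inv !size_rev !size_map.
Qed.

(** A definition at the end of the walk lets the next walk go one letter further,
so the unread part of the word gets shorter and the scan stops. *)
Lemma scan_total E k s l : valid E -> live E k -> live E l ->
  exists E', [/\ scan cletters E k s l E', valid E', refines E E' &
    walk E' (class E' k) s = Some (class E' l)].
Proof.
have [n] := ubnP (size (trace E k s l).1.2).
elim: n E k s l => // n IH E k s l lt_n vE lk ll.
have [stE le_g spE] := vE; have [wfE _] := stE.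
case tr: (trace E k s l) lt_n => [[k' m] l'] /= lt_n.
have [u [v [def_s ku lv stop_k stop_l]]] := trace_spec tr.
have lk' : live E k' by exact: settled_walk ku lk.
have ll' : live E l' by exact: settled_walk lv ll.
have vl : walk E l' v = Some l by rewrite -[v]word_invK; apply: walk_inv.
(* The two ends have been walked already: only the middle part matters. *)
suff [E' [scE' vE' refE' mE']] : exists E', [/\ scan cletters E k s l E', valid E',
    refines E E' & walk E' (class E' k') m = Some (class E' l')].
  exists E'; split=> //; have [stE' _ _] := vE'; rewrite def_s.
  rewrite (walk_catS _ (refines_walk stE' refE' ku)) (walk_catS _ mE').
  exact: refines_walk vl.
case: m tr lt_n stop_k stop_l def_s => [|y [|z m]] tr lt_n stop_k stop_l _.
- have [eq_kl|neq_kl] := eqVneq k' l'.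
    exists E; rewrite eq_kl in tr *; split=> //; [exact: scan_closed tr|exact: refines_refl].
  have [E' [coE' stE' refE' nE' eq_c]] := coincidence_total stE lk' ll'.
  exists E'; split=> //; last by rewrite eq_c.
    by apply: scan_coincidence tr _ coE'; apply/eqP.
  exact: valid_same_rows nE'.
- have kN := stop_k y [::] erefl; have lN := stop_l y [::] erefl.
  have stE' := settled_deduction stE lk' ll' kN lN.
  have refE' := refines_deduction wfE kN lN.
  exists (deduction E k' y l'); split=> //.
  + exact: scan_deduction tr.
  + exact: (valid_same_rows vE).
  rewrite walk_cons; have kE : tab (deduction E k' y l') k' y = Some l'.
    rewrite tab_deduction !eqxx andbC; case: eqP => // ey.
    by have := bar_neq y; rewrite -ey eqxx.
  by rewrite (refines_tab stE' (refines_refl stE'.1) kE).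
have kN := stop_k y (z :: m) erefl.
have vD := valid_define vE lk' kN.
have refD := refines_define wfE kN.
have [||||E' [scE' vE' refE' mE']] := IH (define E k' y) k' [:: y, z & m] l'; try exact: live_define; last first.
- exists E'; split=> //; last exact: refines_trans refE'.
  exact: scan_define tr scE'.
- exact: vD.
apply: leq_ltn_trans (size_trace _ _ _ _) _; rewrite forward_cons tab_define_new.
rewrite -ltnS; apply: leq_ltn_trans lt_n.
exact: (size_forward _ _ (z :: m)).
Qed.

(** * The steps of the enumeration *)

Lemma valid_init : valid (init R).
Proof.
have c0 k : class (init R) k = k by exact: class_of_fixed.
split=> // i; rewrite /row /= => /andP[].
by case: i => // i _ lt_i; exists (Ordinal lt_i), [::]; rewrite !c0.
Qed.

Lemma scan_primary_total E rs : valid E ->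
  exists E', [/\ scan_primary cletters E rs E', valid E', refines E E' &
    forall i (u : free_group g) j, (i, u, j) \in rs ->
      walk E' (class E' i.+1) (val u) = Some (class E' j.+1)].
Proof.
elim: rs E => [|[[i u] j] rs IH] E vE.
  have [[wfE _] _ _] := vE.
  by exists E; split=> //; [exact: scan_primary_nil|exact: refines_refl].
have gen_live (a : 'I_g) : live E (class E a.+1).
  have [[wfE _] le_g _] := vE; rewrite liveE // class_idem // eqxx andbT.
  by apply: class_row => //; rewrite /row /= (leq_trans (ltn_ord a)).
have [E1 [sc1 v1 ref1 walk1]] := scan_total (val u) vE (gen_live i) (gen_live j).
have [E' [sc' vE' ref' walk']] := IH _ v1.
exists E'; split=> //; [exact: scan_primary_cons sc'|exact: refines_trans ref'|].
move=> i' u' j'; rewrite inE => /orP[/eqP[-> -> ->]|]; last exact: walk'.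
have [stE' _ _] := vE'; have := refines_walk stE' ref' walk1.
by rewrite !(ref_class ref1) !(ref_class ref').
Qed.

Lemma scan_secondary_total i E (us : seq (free_group g)) : valid E ->
  exists E', [/\ scan_secondary cletters i E us E', valid E', refines E E' &
    live E' i -> {in us, forall u, walk E' i (val u) = Some i}].
Proof.
elim: us E => [|u us IH] E vE; have [[wfE _] _ _] := vE.
  by exists E; split=> //; [exact: scan_secondary_nil|exact: refines_refl].
have [li|nli] := boolP (live E i); last first.
  exists E; split=> //; [|exact: refines_refl|by rewrite (negPf nli)].
  exact: scan_secondary_break.
have [E1 [sc1 v1 ref1 walk1]] := scan_total (val u) vE li li.
have [E' [sc' vE' ref' walk']] := IH _ v1.
exists E'; split=> //; [exact: scan_secondary_cons sc'|exact: refines_trans ref'|].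
move=> li' u'; rewrite inE => /orP[/eqP->|]; last exact: walk'.
have [stE' _ _] := vE'; have := refines_walk stE' ref' walk1.
by rewrite (ref_class ref'); case/andP: li' => _ /eqP /class_of_fixed ->.
Qed.

Lemma fill_live_row i E ys : valid E -> live E i ->
  let E' := foldl (fun E' y => if tab E' i y is None then define E' i y else E') E ys in
  [/\ valid E', refines E E', live E' i &
      {in ys, forall y, exists j, tab E' i y = Some j}].
Proof.
elim: ys E => [|y ys IH] E vE li; have [[wfE _] _ _] := vE.
  by split=> //; apply: refines_refl.
set E1 := if tab E i y is None then define E i y else E.
have [v1 l1 ref1 [j iE1]] : [/\ valid E1, live E1 i, refines E E1 &
    exists j, tab E1 i y = Some j].
  rewrite /E1; case iE: (tab E i y) => [j|].
    by split=> //; [exact: refines_refl|exists j].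
  split; [exact: valid_define|exact: live_define|exact: refines_define|].
  by exists (nrows E).+1; apply: tab_define_new.
move=> E'; have [vE' ref' li' tab'] := IH E1 v1 l1.
have -> : E' = foldl (fun E' y => if tab E' i y is None then define E' i y else E') E1 ys
  by [].
split=> //; first exact: refines_trans ref'.
move=> z; rewrite inE => /orP[/eqP->|]; last exact: tab'.
have [stE' _ _] := vE'; have := refines_tab stE' ref' iE1.
by case/andP: li' => _ /eqP /class_of_fixed ->; exists (class E' j).
Qed.

Section Loop.
Variables (R2 : seq (free_group g)) (dletters : seq (letter g)).
Hypothesis dletters_all : forall y, y \in dletters.

Definition loop_step i E E' : Prop :=
  exists E1, scan_secondary cletters i E R2 E1 /\ E' = fill_row dletters E1 i.

(** What the treatment of row [i] achieves, if that row survives. *)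
Definition treated E i : Prop := live E i ->
  {in R2, forall u, walk E i (val u) = Some i} /\
  (forall y, exists j, tab E i y = Some j).

Lemma loop_step_total i E : valid E ->
  exists E', [/\ loop_step i E E', valid E', refines E E' & treated E' i].
Proof.
move=> vE; have [E1 [sc1 v1 ref1 walk1]] := scan_secondary_total i R2 vE.
exists (fill_row dletters E1 i); rewrite /fill_row.
case: ifP => li; last by split=> //; [exists E1; rewrite /fill_row li|rewrite /treated li].
have [vE' ref' li' tab'] := fill_live_row dletters v1 li.
split=> //; [by exists E1; rewrite /fill_row li|exact: refines_trans ref'|].
move=> _; split=> [u uR2|y]; last exact: tab'.
have [stE' _ _] := vE'; have := refines_walk stE' ref' (walk1 li u uR2).
by case/andP: li' => _ /eqP /class_of_fixed ->.
Qed.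

(** The guard of the loop is left out, so that the steps form an infinite
sequence, along which limits can be taken. *)
Lemma run_exists : exists E_ : nat -> table,
  [/\ scan_primary cletters (init R) R (E_ 0),
      forall t, loop_step t.+1 (E_ t) (E_ t.+1),
      forall t, valid (E_ t), forall t, refines (E_ t) (E_ t.+1) &
      (forall i (u : free_group g) j, (i, u, j) \in R ->
         walk (E_ 0) (class (E_ 0) i.+1) (val u) = Some (class (E_ 0) j.+1)) /\
      forall t, treated (E_ t.+1) t.+1].
Proof.
have [E0 [sc0 v0 _ walk0]] := scan_primary_total R valid_init.
have /choice[next nextP] (p : nat * table) : exists E', valid p.2 ->
    [/\ loop_step p.1.+1 p.2 E', valid E', refines p.2 E' & treated E' p.1.+1].
  have [/(loop_step_total p.1.+1)[E' ?]|nv] := pselect (valid p.2); first by exists E'.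
  by exists p.2 => /nv.
pose fix E_ t := if t is s.+1 then next (s, E_ s) else E0.
have vE t : valid (E_ t) by elim: t => //= t /(nextP (t, _))[].
by exists E_; split=> // [t|t|]; [| |split=> // t]; have [] := nextP (t, E_ t) (vE t).
Qed.

(** The loop is followed up to the first time at which its guard fails. *)
Lemma completes_of_run (E_ : nat -> table) t :
  scan_primary cletters (init R) R (E_ 0) ->
  (forall s, loop_step s.+1 (E_ s) (E_ s.+1)) -> max_live (E_ t) <= t ->
  exists M, 0 < M /\ completes R R2 cletters dletters M.
Proof.
move=> sc0 step stop; pose stops s := max_live (E_ s) <= s.
have [m stop_m min_m] := @ex_minnP stops (ex_intro _ t stop).
exists m.+1; split=> //; exists (E_ m), (E_ 0), (E_ m), m.+1.
split=> //; last by have -> : max_live (E_ m) < m.+1 by [].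
suff from s : s <= m -> main_loop R2 cletters dletters m.+1 (E_ (m - s)) (m - s).+1
    (E_ m) m.+1 by have := from m (leqnn m); rewrite subnn.
elim: s => [|s IH] le_sm.
  by rewrite subn0; apply: main_loop_stop; rewrite leqnn andbT -leqNgt.
have [E1 [sc1 def_E]] := step (m - s.+1).
have lt_m : m - s.+1 < m by rewrite -subn_gt0 subKn.
apply: main_loop_step sc1 _.
  rewrite ltnS (ltnW lt_m) andbT ltnNge; apply/negP => /min_m.
  by rewrite leqNgt lt_m.
by rewrite -def_E; have := IH (ltnW le_sm); rewrite -subnSK.
Qed.

End Loop.
End Procedures.
End Tables.

(** * Actions of the free group and the presented rack *)

Section Action.
Variables (g : nat) (R : seq (primary_relation g)).
Variables (D : pred nat) (act : nat -> letter g -> nat).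
Hypothesis act_closed : forall k y, D k -> D (act k y).
Hypothesis act_bar : forall k y, D k -> act (act k y) (bar y) = k.
Implicit Types u v : free_group g.

Lemma act_word_closed k (w : word g) : D k -> D (foldl act k w).
Proof. by elim: w k => //= y w IH k Dk; apply/IH/act_closed. Qed.

(** Free cancellation is invisible to the action. *)
Lemma act_wmul k (u v : word g) : D k ->
  foldl act k (wmul u v) = foldl act (foldl act k u) v.
Proof.
have act_push y w l : D l -> foldl act l (push y w) = foldl act (act l y) w.
  by case: w => // z w Dl /=; case: eqP => // ->; rewrite act_bar.
elim: u k => //= y u IH k Dk; rewrite act_push // IH //; exact: act_closed.
Qed.

Definition act_fg k u : nat := foldl act k (val u).

Lemma act_fg_closed k u : D k -> D (act_fg k u).
Proof. exact: act_word_closed. Qed.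

Lemma act_fgM k u v : D k -> act_fg k (u * v)%g = act_fg (act_fg k u) v.
Proof. exact: act_wmul. Qed.

Lemma act_fgK k u : D k -> act_fg (act_fg k u) u^-1%g = k.
Proof. by move=> Dk; rewrite -act_fgM // mulgV. Qed.

Lemma act_fgVK k u : D k -> act_fg (act_fg k u^-1%g) u = k.
Proof. by move=> Dk; rewrite -act_fgM // mulVg. Qed.

Variable base : 'I_g -> nat.
Hypothesis base_D : forall a, D (base a).
Hypothesis act_primary : forall i u j, (i, u, j) \in R -> act_fg (base i) u = base j.
Hypothesis act_secondary : forall r k, r \in R -> D k -> act_fg k (secondary r) = k.

Definition point (x : free_rack g) : nat := act_fg (base x.1) x.2.

(** The action of a symbol a^w on the right, as an element of the free group. *)
Definition inner (x : free_rack g) : free_group g := (x.2^-1 * fg_gen x.1 * x.2)%g.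

Lemma point_D x : D (point x).
Proof. exact: act_fg_closed. Qed.

Lemma act_fg_inj u v : (forall k, D k -> act_fg k u = act_fg k v) ->
  forall k, D k -> act_fg k u^-1%g = act_fg k v^-1%g.
Proof.
move=> uv k Dk; have Dl := act_fg_closed u^-1%g Dk.
by rewrite -{2}(act_fgVK u Dk) uv // act_fgK.
Qed.

(** The operations of the free rack only depend on the base row and on the
inner action of the arguments. Since the secondary relation of [x_i^u = x_j]
says that the inner actions of its two sides agree, being sent to the same row
while acting in the same way is a congruence that contains the relations. *)
Lemma congruence_point x y : generated_congruence (relation_pair R) x y ->
  point x = point y /\ forall k, D k -> act_fg k (inner x) = act_fg k (inner y).
Proof.
have point_op a b : point (rop a b) = act_fg (point a) (inner b).
  by rewrite /point /inner /= -act_fgM // !mulgA.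
have point_inv a b : point (rinv a b) = act_fg (point a) (inner b)^-1%g.
  by rewrite /point /inner /= -act_fgM // !invgM invgK !mulgA.
have inner_op a b : inner (rop a b) = ((inner b)^-1 * inner a * inner b)%g.
  by rewrite /inner /= !invgM !invgK !mulgA.
have inner_inv a b : inner (rinv a b) = (inner b * inner a * (inner b)^-1)%g.
  by rewrite /inner /= !invgM !invgK !mulgA.
have act_conj u u' v v' : (forall k, D k -> act_fg k u = act_fg k u') ->
    (forall k, D k -> act_fg k v = act_fg k v') ->
    forall k, D k -> act_fg k (v^-1 * u * v)%g = act_fg k (v'^-1 * u' * v')%g.
  move=> uu vv k Dk; rewrite !act_fgM ?act_fg_closed //.
  by rewrite (act_fg_inj vv Dk) uu ?vv ?act_fg_closed.
elim=> {x y} [x y [i [u [j [ijR [-> ->]]]]]|//|x y _ [px ix]|x y z _ [px ix] _ [py iy]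
             |x x' y y' _ [px ix] _ [py iy]|x x' y y' _ [px ix] _ [py iy]].
- split=> [|k Dk]; first by rewrite /point /= (act_primary ijR).
  have -> : inner (fr_gen j) = fg_gen j by rewrite /inner /= invg1 mul1g mulg1.
  have := act_secondary ijR Dk; rewrite /secondary act_fgM // -/(inner (i, u)) => eq_k.
  by rewrite -{2}eq_k act_fgVK //; apply: act_fg_closed.
- by split=> // k Dk; rewrite ix.
- by split=> [|k Dk]; rewrite ?px ?ix ?iy.
- split=> [|k Dk]; first by rewrite !point_op px iy //; apply: point_D.
  by rewrite !inner_op; apply: act_conj.
- split=> [|k Dk]; first by rewrite !point_inv px (act_fg_inj iy) //; apply: point_D.
  rewrite !inner_inv -{1}[inner y]invgK -{1}[inner y']invgK.
  by apply: act_conj => //; apply: act_fg_inj.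
Qed.

(** The map [point] factors through the presented rack, and its image is the
union of the orbits of the base rows. *)
Lemma finite_orbits : finite_set [set: presented_rack R] ->
  exists m, forall a u, act_fg (base a) u < m.
Proof.
move=> fin; have [s def_s] : exists s : seq nat,
    [set` s]%classic = [set point (repr p) | p in [set: presented_rack R]]%classic.
  by have /finite_seqP[s ->] := finite_image (fun p => point (repr p)) fin; exists s.
exists (\max_(n <- s) n).+1 => a u; rewrite ltnS.
have : [set` s]%classic (act_fg (base a) u).
  rewrite def_s; exists (\pi_(presented_rack R)%qT (a, u)) => //.
  by have [] := congruence_point (repr_pi_cong R (a, u)).
by move=> /= in_s; exact: (@leq_bigmax_seq _ s xpredT id).
Qed.

End Action.

(** * The limit of an infinite run *)

Section Limit.
Local Open Scope classical_set_scope.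
Variables (g : nat) (R : seq (primary_relation g)) (R2 : seq (free_group g)).
Variable E_ : nat -> table R.
Hypothesis E_valid : forall t, valid (E_ t).
Hypothesis E_refines : forall t, refines (E_ t) (E_ t.+1).
Hypothesis E_primary : forall i (u : free_group g) j, (i, u, j) \in R ->
  walk (E_ 0) (class (E_ 0) i.+1) (val u) = Some (class (E_ 0) j.+1).
Hypothesis E_treated : forall t, treated R2 (E_ t.+1) t.+1.
Hypothesis E_endless : forall t, t < max_live (E_ t).

Let E_settled t : settled (E_ t). Proof. by have [] := E_valid t. Qed.
Let E_wf t : well_formed (E_ t). Proof. by have [] := E_settled t. Qed.

Lemma refines_run s t : s <= t -> refines (E_ s) (E_ t).
Proof.
elim: t => [|t IH]; first by rewrite leqn0 => /eqP->; apply: refines_refl.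
rewrite leq_eqVlt => /orP[/eqP-> |]; first exact: refines_refl.
by rewrite ltnS => /IH; move/refines_trans; apply.
Qed.

Lemma class_run s t k : s <= t -> class (E_ t) (class (E_ s) k) = class (E_ t) k.
Proof. by move=> /refines_run/ref_class. Qed.

Lemma walk_run s t k w l : s <= t -> walk (E_ s) k w = Some l ->
  walk (E_ t) (class (E_ t) k) w = Some (class (E_ t) l).
Proof. by move=> /refines_run/refines_walk; apply. Qed.

(** The classes of a row decrease along the run. *)
Lemma class_converges k : exists l, \forall t \near \oo, class (E_ t) k = l.
Proof.
pose hit l := `[< exists t, class (E_ t) k = l >].
have ex_hit : exists l, hit l by exists (class (E_ 0) k); apply/asboolP; exists 0.
have [l /asboolP[T def_l] min_l] := ex_minnP ex_hit.
exists l, T => // t /= le_Tt; apply/eqP; rewrite eqn_leq min_l ?andbT; last first.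
  by apply/asboolP; exists t.
by rewrite -(class_run k le_Tt) def_l class_le.
Qed.

Definition limit k : nat := projT1 (cid (class_converges k)).

Lemma limitP k : \forall t \near \oo, class (E_ t) k = limit k.
Proof. by rewrite /limit; case: cid. Qed.

Lemma limit_le_class k t : limit k <= class (E_ t) k.
Proof.
have [T _ limT] := limitP k; have le_T := leq_maxl T t; have le_t := leq_maxr T t.
by rewrite -(limT _ le_T) -(class_run k le_t) class_le.
Qed.

Lemma limit_idem k : limit (limit k) = limit k.
Proof.
have [T [cl cll]] := filter_ex (filterI (limitP k) (limitP (limit k))).
by rewrite -cll -cl class_idem // cl.
Qed.

Definition permanent : pred nat := [pred k | (0 < k) && (limit k == k)].

Lemma permanent_limit k : 0 < k -> permanent (limit k).
Proof.
move=> k_gt0; rewrite /permanent /= limit_idem eqxx andbT.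
by have [t <-] := filter_ex (limitP k); apply: class_pos.
Qed.

Lemma permanent_class k t : permanent k -> class (E_ t) k = k.
Proof.
case/andP=> _ /eqP lim_k; apply/eqP; rewrite eqn_leq class_le /=.
by rewrite -{1}lim_k limit_le_class.
Qed.

Lemma max_live_le m (E : table R) : (forall k, live E k -> k <= m) -> max_live E <= m.
Proof. by move=> le_m; apply/bigmax_leqP_seq => k _ /le_m. Qed.

(** Since the run is endless, it treats row [k] at a time when the row exists. *)
Lemma permanent_live k : permanent k -> live (E_ k) k.
Proof.
move=> pk; rewrite liveE // permanent_class // eqxx andbT; case/andP: pk => k_gt0 _.
rewrite /row k_gt0; case: k k_gt0 => // t _.
apply: leq_trans (ref_nrows (E_refines t)); apply: leq_trans (E_endless t) _.
by apply: max_live_le => l /andP[/andP[]].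
Qed.

Lemma permanent_treated k : permanent k ->
  {in R2, forall u, walk (E_ k) k (val u) = Some k} /\
  (forall y, exists j, tab (E_ k) k y = Some j).
Proof.
move=> pk; have := permanent_live pk; case: k pk => [/andP[]//|t] _ /E_treated //.
Qed.

Lemma permanent_tab k y : permanent k ->
  exists l, permanent l /\ \forall t \near \oo, tab (E_ t) k y = Some l.
Proof.
move=> pk; have [_ /(_ y)[j kE]] := permanent_treated pk; exists (limit j); split.
  by apply: permanent_limit; have /andP[] := wf_tabr (E_wf k) kE.
have ge_k : \forall t \near \oo, k <= t by exists k.
apply: filterS2 ge_k (limitP j) => t le_kt <-.
rewrite -{1}(permanent_class t pk).
exact: refines_tab (E_settled t) (refines_run le_kt) kE.
Qed.

(** The permanent rows are images of elements of the presented rack under the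
limit action. If they are finitely many, then at a late time every walk from a
generator runs through permanent rows, and no other row is live. *)
Lemma endless_infinite : perm_eq R2 (undup [seq secondary r | r <- R]) ->
  ~ finite_set [set: presented_rack R].
Proof.
move=> eqR2 fin.
have /choice[act' act'P] (p : nat * letter g) : exists l, permanent p.1 ->
    permanent l /\ \forall t \near \oo, tab (E_ t) p.1 p.2 = Some l.
  have [/(permanent_tab p.2)[l ?]|np] := boolP (permanent p.1); first by exists l.
  by exists 0.
pose act k y := act' (k, y).
have act_closed k y : permanent k -> permanent (act k y) by move/(act'P (k, y))=> [].
have act_tab k y : permanent k -> \forall t \near \oo, tab (E_ t) k y = Some (act k y).
  by move/(act'P (k, y))=> [].
have act_walk k w : permanent k ->
    \forall t \near \oo, walk (E_ t) k w = Some (foldl act k w).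
  elim: w k => [|y w IH] k pk; first exact: nearW.
  apply: filterS2 (act_tab k y pk) (IH _ (act_closed k y pk)) => t kE actE.
  by rewrite walk_cons kE.
(* A walk that is eventually in the table gives the value of the limit action. *)
have act_val k w l : permanent k -> (\forall t \near \oo, walk (E_ t) k w = Some l) ->
    foldl act k w = l.
  move=> pk kl; have [t [-> []//]] := filter_ex (filterI (act_walk k w pk) kl).
have act_bar k y : permanent k -> act (act k y) (bar y) = k.
  move=> pk; apply: (act_val (act k y) [:: bar y]); first exact: act_closed.
  apply: filterS (act_tab k y pk) => t kE.
  by rewrite walk_cons (wf_bar (E_wf t) kE).
pose base (a : 'I_g) := limit a.+1.
have base_P a : permanent (base a) by exact: permanent_limit.
have ge_t s : \forall t \near \oo, s <= t by exists s.
have act_primary i (u : free_group g) j : (i, u, j) \in R -> act_fg act (base i) u = base j.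
  move=> ijR; apply: act_val => //.
  apply: filterS2 (limitP i.+1) (limitP j.+1) => t ci cj.
  have := walk_run (leq0n t) (E_primary ijR).
  by rewrite !class_run // ci cj.
have act_secondary r k : r \in R -> permanent k -> act_fg act k (secondary r) = k.
  move=> rR pk; have [closed _] := permanent_treated pk.
  have uR2 : secondary r \in R2 by rewrite (perm_mem eqR2) mem_undup map_f.
  apply: act_val => //; apply: filterS (ge_t k) => t le_kt.
  by have := walk_run le_kt (closed _ uR2); rewrite permanent_class.
have [m bound] := finite_orbits act_closed act_bar base_P act_primary act_secondary fin.
have act_bound a w : foldl act (base a) w < m.
  (* A walk in the table may read a word that is not reduced. *)
  have := bound a (FreeGroup (@reduced_wmul g w [::] isT)).
  by rewrite /act_fg /= (act_wmul act_closed act_bar).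
have spanned_act k : permanent k -> exists a w, k = foldl act (base a) w.
  move=> pk; have [_ _ /(_ k)] := E_valid k.
  case=> [|a [w aw]]; first by have /andP[] := permanent_live pk.
  exists a, w; apply/esym/act_val => //.
  apply: filterS2 (ge_t k) (limitP a.+1) => t le_kt ca.
  by have := walk_run le_kt aw; rewrite !class_run // ca permanent_class.
have small k : permanent k -> k < m by move=> /spanned_act[a [w ->]].
have tab_final : \forall t \near \oo, forall (p : 'I_m * letter g), permanent p.1 ->
    tab (E_ t) p.1 p.2 = Some (act p.1 p.2).
  apply: filter_forall => p; have [/(act_tab _ p.2)|np] := boolP (permanent p.1).
    by apply: filterS => t.
  exact: nearW.
have base_final : \forall t \near \oo, forall a : 'I_g, class (E_ t) a.+1 = base a.
  by apply: filter_forall => a; apply: limitP.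
have [t [[tabE baseE] le_mt]] := filter_ex (filterI (filterI tab_final base_final) (ge_t m)).
have walk_final k w : permanent k -> walk (E_ t) k w = Some (foldl act k w).
  elim: w k => [//|y w IH] k pk.
  rewrite walk_cons (tabE (Ordinal (small k pk), y) pk) /=.
  by rewrite IH //; apply: act_closed.
have := E_endless t; rewrite ltnNge => /negP; apply; apply: max_live_le => k.
rewrite liveE // => /andP[rk /eqP ck]; apply: leq_trans le_mt; apply/ltnW/small.
have [_ _ /(_ k rk)[a [w]]] := E_valid t; rewrite ck baseE walk_final // => -[<-].
exact: act_word_closed.
Qed.

End Limit.

Theorem theorem4p3 (g : nat) (hg : 0 < g)
    (R : seq (primary_relation g)) (hR : uniq R)
    (R2 : seq (free_group g))
    (hR2 : perm_eq R2 (undup [seq secondary r | r <- R]))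
    (cletters dletters : seq (letter g))
    (hc : perm_eq cletters (enum {: letter g}))
    (hd : perm_eq dletters (enum {: letter g})) :
  finite_set [set: presented_rack R] ->
  exists M, 0 < M /\ completes R R2 cletters dletters M.
Proof.
move=> fin.
have cletters_all y : y \in cletters by rewrite (perm_mem hc) mem_enum.
have dletters_all y : y \in dletters by rewrite (perm_mem hd) mem_enum.
have [E_ [sc0 step vE refE [prim treat]]] := run_exists R cletters_all R2 dletters_all.
have [[t stop]|endless] := pselect (exists t, max_live (E_ t) <= t).
  exact: completes_of_run sc0 step stop.
case: (@endless_infinite g R R2 E_) => // t.
by rewrite ltnNge; apply/negP => stop; apply: endless; exists t.
Qed.
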